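(* Let $G$ be a connected walk-regular graph with spectrum $\{\theta_0^{m_0},\theta_1^{m_1},\ldots,\theta_d^{m_d}\}$, $\theta_0>\theta_1>\cdots>\theta_d$, and let $\pi_i=\prod_{j=0,j\neq i}^{d}|\theta_i-\theta_j|$ for $i=0,\ldots,d$. Then: (i) for every $i=1,\ldots,\lfloor d/2\rfloor$ with $m_{2i}\neq \pi_0/\pi_{2i}$, we have $\alpha_{d-1}\le m_{2i}$; (ii) for every $i=1,\ldots,\lceil d/2\rceil$, we have $\alpha_{d-1}\le 1+m_{2i-1}$ and $\alpha_{d-1}\le 1+m_{2i-1}\,\pi_{2i-1}/\pi_0$.
   Context: A graph is walk-regular if the number of closed walks of any given length from a vertex to itself does not depend on the vertex. The $(d-1)$-independence number $\alpha_{d-1}$ is the maximum number of vertices pairwise at distance greater than $d-1$. *)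

(* Defs.v *)
From mathcomp Require Import all_boot all_order all_algebra.

Set Implicit Arguments.
Unset Strict Implicit.
Unset Printing Implicit Defensive.

Import Order.TTheory GRing.Theory Num.Theory.

(* A finite simple graph on T is given by its adjacency relation. *)
Definition simple_graph (T : finType) (e : rel T) : Prop :=
  symmetric e /\ irreflexive e.

Definition connected_graph (T : finType) (e : rel T) : Prop :=
  forall x y : T, connect e x y.

(* The walks x, t_0, ..., t_(k-1) = y of length k; the starting vertex is not
   stored in the tuple. *)
Definition walks (T : finType) (e : rel T) (k : nat) (x y : T) :
    {set k.-tuple T} :=
  [set t : k.-tuple T | path e x t && (last x t == y)].

Definition walk_regular (T : finType) (e : rel T) : Prop :=
  forall (k : nat) (x y : T), #|walks e k x x| = #|walks e k y y|.

(* The least length of a walk from x to y. Two vertices in the same component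
   are at distance < #|T|, so the search bound is harmless; vertices in
   different components get the junk value #|T|. *)
Definition gdist (T : finType) (e : rel T) (x y : T) : nat :=
  find (fun k => walks e k x y != set0) (iota 0 #|T|).

Definition k_independent (T : finType) (e : rel T) (k : nat) (U : {set T}) :
    bool :=
  [forall x in U, forall y in U, (x != y) ==> (k < gdist e x y)].

Definition k_indep_number (T : finType) (e : rel T) (k : nat) : nat :=
  \max_(U : {set T} | k_independent e k U) #|U|.

Local Open Scope ring_scope.

Definition adjmx (R : pzRingType) (T : finType) (e : rel T) : 'M[R]_#|T| :=
  \matrix_(i, j) (e (enum_val i) (enum_val j))%:R.

(* The spectrum of the graph is {theta_0^m_0, ..., theta_d^m_d} with
   theta_0 > ... > theta_d; the values of theta and m beyond d are irrelevant. *)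
Definition has_spectrum (R : realFieldType) (T : finType) (e : rel T) (d : nat)
    (theta : nat -> R) (m : nat -> nat) : Prop :=
  [/\ forall i j : nat, (i < j <= d)%N -> theta j < theta i,
      forall i : nat, (i <= d)%N -> (0 < m i)%N
    & char_poly (adjmx R e) = \prod_(i < d.+1) ('X - (theta i)%:P) ^+ m i].

Definition spi (R : realFieldType) (d : nat) (theta : nat -> R) (i : nat) : R :=
  \prod_(j < d.+1 | j != i :> nat) `|theta i - theta j|.

(* Main.v *)
(** Let [E_i = L_i(A)] be the spectral idempotents of the adjacency matrix [A],
    with [L_i] the Lagrange polynomials of degree [d] at the distinct
    eigenvalues. Walk-regularity makes the diagonal of [E_i] constant, equal to
    [m_i / n]. If [u] and [v] are at distance at least [d], only the leading
    term of [L_i] contributes to [(E_i)_uv], which is therefore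
    [(-1)^i (A^d)_uv / pi_i]; as [E_0] is the constant matrix [1/n], this equals
    [(-1)^i (pi_0 / pi_i) / n]. Hence the principal submatrix of [n E_i] on a set
    of vertices pairwise at distance at least [d] is [(m_i - r) I + r J] with
    [r = (-1)^i pi_0 / pi_i]. It is positive semidefinite of rank at most [m_i],
    which bounds its size. *)

Require Import Defs.
From mathcomp Require Import all_boot all_order all_algebra.
From mathcomp Require Import ring lra zify.

Set Implicit Arguments.
Unset Strict Implicit.
Unset Printing Implicit Defensive.

Import Order.TTheory GRing.Theory Num.Theory.
Local Open Scope ring_scope.

(** * Nilpotent symmetric matrices and polynomials in a matrix *)

(** Each diagonal entry of [B *m B] is the sum of the squares of a row of [B]. *)
Lemma sym_sqr_eq0 (R : realFieldType) (n : nat) (B : 'M[R]_n) :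
  B^T = B -> B *m B = 0 -> B = 0.
Proof.
move=> Bsym B2; have Bij i j : B i j = B j i by rewrite -[in LHS]Bsym mxE.
apply/matrixP => i j; rewrite mxE.
have /matrixP/(_ i i) := B2; rewrite !mxE => /eqP.
rewrite psumr_eq0 => [|k _]; last by rewrite [B k i]Bij -expr2 sqr_ge0.
by move=> /allP/(_ j (mem_index_enum _)) /=;
   rewrite [B j i]Bij mulf_eq0 orbb => /eqP.
Qed.

Lemma sym_nilpotent_eq0 (R : realFieldType) (n k : nat) (B : 'M[R]_n.+1) :
  B^T = B -> B ^+ k = 0 -> B = 0.
Proof.
move=> Bsym; have BkT j : (B ^+ j)^T = B ^+ j.
  by elim: j => [|j IHj]; rewrite ?trmx1 // exprS trmx_mul IHj Bsym -[LHS]exprSr exprS.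
(* Halve the exponent: [B ^+ uphalf k] is symmetric with zero square. *)
have [N] := ubnP k; elim: N k => // N IHN [|[|k]] kN Bk0.
- by have := matrix_nonzero1 R n; rewrite -Bk0 expr0 eqxx.
- by rewrite -[B]expr1.
apply: (IHN (uphalf k.+2)); first lia.
apply: sym_sqr_eq0 => //; rewrite -[LHS]/(_ * _) -exprD.
have ->: (uphalf k.+2 + uphalf k.+2 = k.+2 + odd k.+2)%N by rewrite addnn; lia.
by rewrite exprD Bk0 mul0r.
Qed.

Lemma trmx_horner_mx (R : comNzRingType) (n : nat) (A : 'M[R]_n.+1)
    (p : {poly R}) :
  A^T = A -> (horner_mx A p)^T = horner_mx A p.
Proof.
move=> Asym; elim/poly_ind: p => [|p c IHp]; first by rewrite !raddf0.
rewrite raddfD /= rmorphM /= horner_mx_X horner_mx_C raddfD /= tr_scalar_mx.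
by rewrite trmx_mul Asym IHp; congr (_ + _); exact: (comm_mx_horner p (erefl _)).
Qed.

Lemma horner_mx_coef (R : comNzRingType) (n k : nat) (A : 'M[R]_n.+1)
    (p : {poly R}) x y :
  (size p <= k)%N ->
  horner_mx A p x y = \sum_(i < k) p`_i * (A ^+ i) x y.
Proof.
move=> szp; have {1}-> : p = \poly_(i < k) p`_i.
  by apply/polyP => i; rewrite coef_poly;
     case: ltnP => // ki; rewrite nth_default // (leq_trans szp).
rewrite poly_def raddf_sum summxE; apply: eq_bigr => i _.
by rewrite /= horner_mxZ /= rmorphXn /= horner_mx_X mxE.
Qed.

(** * Diagonalization and traces *)

Lemma char_poly_conj (F : fieldType) (n : nat) (P A : 'M[F]_n) :
  P \in unitmx -> char_poly (invmx P *m A *m P) = char_poly A.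
Proof.
move=> Pu; rewrite /char_poly.
have -> : char_poly_mx (invmx P *m A *m P)
    = map_mx polyC (invmx P) *m char_poly_mx A *m map_mx polyC P.
  rewrite /char_poly_mx mulmxBr mulmxBl -!map_mxM; congr (_ - _).
  by rewrite scalar_mxC -mulmxA -map_mxM mulVmx // map_mx1 mulmx1.
rewrite !det_mulmx !det_map_mx mulrAC -polyCM -det_mulmx mulVmx // det1.
by rewrite mul1r.
Qed.

(** In the rank factorization of [E], idempotence makes the product of the two factors in reverse
    order the identity of size [\rank E]; the trace is cyclic. *)
Lemma idem_rank_tr (F : fieldType) (n : nat) (E : 'M[F]_n) :
  E *m E = E -> \tr E = (\rank E)%:R.
Proof.
move=> EE; rewrite -{1}(mulmx_base E) mxtrace_mulC.
suff -> : row_base E *m col_base E = 1%:M by rewrite mxtrace1.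
apply: (row_full_inj (col_base_full E)); apply: (row_free_inj (row_base_free E)).
by rewrite mulmx1 -mulmxA -mulmxA mulmx_base mulmxA mulmx_base.
Qed.

(** By Cayley-Hamilton the polynomial [q] with simple roots [theta i] takes a nilpotent value at
    [A]. This value is symmetric, so it vanishes; the minimal polynomial then divides [q], and [A]
    is diagonalizable. *)
Lemma sym_diagonalization (R : realFieldType) (n d : nat) (A : 'M[R]_n.+1)
    (theta : nat -> R) (m : nat -> nat) :
  A^T = A -> {in gtn d.+1 &, injective theta} ->
  char_poly A = \prod_(i < d.+1) ('X - (theta i)%:P) ^+ m i ->
  exists P D, [/\ P \in unitmx, A = invmx P *m diag_mx D *m P &
    perm_eq [seq D 0 j | j : 'I_n.+1]
            (flatten [seq nseq (m i) (theta i) | i : 'I_d.+1])].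
Proof.
move=> Asym theta_inj charA.
pose q := \prod_(i < d.+1) ('X - (theta i)%:P).
(* [M] bounds every multiplicity, so [char_poly A] divides [q ^+ M]. *)
pose M := (\sum_(i < d.+1) m i)%N.
have qA0 : horner_mx A q = 0.
  apply: (@sym_nilpotent_eq0 _ _ M); first exact: trmx_horner_mx.
  rewrite -rmorphXn /=.
  suff /dvdpP[r ->] : char_poly A %| q ^+ M.
    by rewrite rmorphM /= Cayley_Hamilton mulr0.
  rewrite charA -prodrXl; apply: (big_ind2 (fun x y => x %| y)) => //.
    by move=> *; exact: dvdp_mul.
  by move=> i _; apply: dvdp_exp2l; rewrite /M (bigD1 i) //= leq_addr.
have /diagonalizableP : exists2 rs, uniq rs &
    mxminpoly A %| \prod_(x <- rs) ('X - x%:P).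
  exists [seq theta i | i : 'I_d.+1].
    rewrite map_inj_in_uniq ?enum_uniq // => i j _ _ /theta_inj eij.
    by apply/val_inj/eij; rewrite inE ltn_ord.
  by rewrite big_map big_enum; exact/mxminpoly_minP.
move=> [P Pu] /diagonalizable_forPex[D /(simmxLR Pu)]; rewrite mxpoly.conjVmx // => AE.
(* Unique factorization of the characteristic polynomial determines the diagonal of [D] up to
   order. *)
exists P, D; split=> //; apply: prod_XsubC_eq.
rewrite big_map big_enum /= big_flatten big_map big_enum /=.
rewrite -[RHS](eq_bigr _ (fun i _ => esym (big_nseq _ _ _ _ _))).
transitivity (char_poly A).
  rewrite AE char_poly_conj // char_poly_trig ?diag_mx_is_trig //.
  by apply: eq_bigr => i _; rewrite mxE eqxx mulr1n.
by rewrite charA; apply: eq_bigr => i _; rewrite -Monoid.iteropE.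
Qed.

(** Diagonalization reduces an identity between polynomials in [A] to their values at the
    [theta i]. *)
Lemma horner_mx_sym_eq0 (R : realFieldType) (n d : nat) (A : 'M[R]_n.+1)
    (theta : nat -> R) (m : nat -> nat) (p : {poly R}) :
  A^T = A -> {in gtn d.+1 &, injective theta} ->
  char_poly A = \prod_(i < d.+1) ('X - (theta i)%:P) ^+ m i ->
  (forall i, (i <= d)%N -> p.[theta i] = 0) -> horner_mx A p = 0.
Proof.
move=> Asym theta_inj charA p0.
have [P [D [Pu -> /perm_mem memD]]] := sym_diagonalization Asym theta_inj charA.
rewrite horner_mx_uconjC // horner_mx_diag.
suff -> : map_mx (horner p) D = 0 by rewrite linear0 mulmx0 mul0mx.
apply/rowP => j; rewrite !mxE.
have : D 0 j \in [seq D 0 j | j : 'I_n.+1] by rewrite map_f ?mem_enum.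
rewrite memD => /flatten_mapP[i _ /nseqP[-> _]].
by rewrite p0 // -ltnS ltn_ord.
Qed.

Lemma mxtrace_horner_sym (R : realFieldType) (n d : nat) (A : 'M[R]_n.+1)
    (theta : nat -> R) (m : nat -> nat) (p : {poly R}) :
  A^T = A -> {in gtn d.+1 &, injective theta} ->
  char_poly A = \prod_(i < d.+1) ('X - (theta i)%:P) ^+ m i ->
  \tr (horner_mx A p) = \sum_(i < d.+1) p.[theta i] *+ m i.
Proof.
move=> Asym theta_inj charA.
have [P [D [Pu -> permD]]] := sym_diagonalization Asym theta_inj charA.
rewrite horner_mx_uconjC // horner_mx_diag.
rewrite mxtrace_mulC mulmxA mulmxV // mul1mx mxtrace_diag.
transitivity (\sum_(x <- [seq D 0 j | j : 'I_n.+1]) p.[x]).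
  by rewrite big_map big_enum; apply: eq_bigr => j _; rewrite mxE.
rewrite (perm_big _ permD) big_flatten big_map big_enum.
by apply: eq_bigr => i _; rewrite big_nseq -Monoid.iteropE.
Qed.

(** * Lagrange polynomials and the numbers [spi] *)

Definition lagrange_poly (R : fieldType) (d : nat) (theta : nat -> R) (i : nat) :
    {poly R} :=
  (\prod_(j < d.+1 | j != i :> nat) (theta i - theta j))^-1
    *: \prod_(j < d.+1 | j != i :> nat) ('X - (theta j)%:P).

Lemma lagrange_poly_node (R : fieldType) (d : nat) (theta : nat -> R) i j :
  {in gtn d.+1 &, injective theta} -> (i <= d)%N -> (j <= d)%N ->
  (lagrange_poly d theta i).[theta j] = (i == j)%:R.
Proof.
move=> theta_inj id jd; rewrite hornerZ horner_prod.
rewrite [X in _ * X](eq_bigr (fun k : 'I_d.+1 => theta j - theta k)) => [|k _]; last first.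
  by rewrite hornerXsubC.
have [<-|neq_ij] := eqVneq i j.
  rewrite mulVf //; apply/prodf_neq0 => k ki; rewrite subr_eq0.
  by apply: contraNneq ki => /theta_inj -> //; rewrite inE.
rewrite [X in _ * X](bigD1 (inord j)) /= ?inordK // 1?eq_sym //.
by rewrite subrr mul0r mulr0.
Qed.

Lemma size_prod_XsubC_neq (R : fieldType) (d : nat) (theta : nat -> R) i :
  (i <= d)%N ->
  size (\prod_(j < d.+1 | j != i :> nat) ('X - (theta j)%:P)) = d.+1.
Proof.
rewrite -ltnS => id; have := size_prod_XsubC (enum 'I_d.+1) theta.
rewrite big_enum size_enum_ord (bigD1 (Ordinal id)) //=.
rewrite size_monicM ?monicXsubC ?monic_neq0 ?monic_prod_XsubC //.
by rewrite size_XsubC => -[].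
Qed.

Lemma size_lagrange_poly (R : fieldType) (d : nat) (theta : nat -> R) i :
  (i <= d)%N -> (size (lagrange_poly d theta i) <= d.+1)%N.
Proof.
move=> id; apply: leq_trans (size_scale_leq _ _) _.
by rewrite size_prod_XsubC_neq.
Qed.

(** This is the only coefficient that matters for an entry at which all powers of the matrix below
    the [d]-th vanish. *)
Lemma lagrange_poly_coef (R : fieldType) (d : nat) (theta : nat -> R) i :
  (i <= d)%N ->
  (lagrange_poly d theta i)`_d =
    (\prod_(j < d.+1 | j != i :> nat) (theta i - theta j))^-1.
Proof.
move=> id; rewrite coefZ.
have := lead_coef_prod_XsubC (index_enum 'I_d.+1) (fun j => j != i :> nat) theta.
by rewrite lead_coefE size_prod_XsubC_neq // => ->; rewrite mulr1.
Qed.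

(** As [theta] decreases, exactly the [i] factors with [j < i] are negative. *)
Lemma prod_sub_spi (R : realFieldType) (d : nat) (theta : nat -> R) i :
  (forall i j : nat, (i < j <= d)%N -> theta j < theta i) -> (i <= d)%N ->
  \prod_(j < d.+1 | j != i :> nat) (theta i - theta j) = (-1) ^+ i * spi d theta i.
Proof.
move=> dec id.
have sgE (j : 'I_d.+1) : j != i :> nat ->
    theta i - theta j = (-1) ^+ (j < i)%N * `|theta i - theta j|.
  rewrite neq_ltn => /orP[] ji.
    rewrite ji ler0_norm ?expr1 ?mulN1r ?opprK // subr_le0 ltW // dec //.
    by rewrite ji.
  rewrite ltnNge ltnW //= expr0 mul1r ger0_norm // subr_ge0 ltW // dec // ji.
  by rewrite -ltnS ltn_ord.
rewrite (eq_bigr _ sgE) big_split /=; congr (_ * _).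
rewrite prodrXr; congr (_ ^+ _).
rewrite -[RHS]card_ord -sum1_card.
rewrite (big_ord_widen d.+1 (fun=> 1%N)); last exact: leqW.
rewrite big_mkcond [RHS]big_mkcond; apply: eq_bigr => j _.
by case: ltngtP.
Qed.

Lemma spi_gt0 (R : realFieldType) (d : nat) (theta : nat -> R) i :
  {in gtn d.+1 &, injective theta} -> (i <= d)%N -> 0 < spi d theta i.
Proof.
move=> theta_inj id; apply: prodr_gt0 => j ji; rewrite normr_gt0 subr_eq0.
by apply: contraNneq ji => /theta_inj -> //; rewrite inE.
Qed.

(** * Principal submatrices of a symmetric idempotent *)

(** As [E = E *m E^T], the form is the squared norm of the combination, with coefficients [v], of
    the rows of [E] selected by [f]. *)
Lemma sym_idem_mxsub_ge0 (R : realFieldType) (n a : nat) (E : 'M[R]_n)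
    (f : 'I_a -> 'I_n) (v : 'rV[R]_a) :
  E^T = E -> E *m E = E -> 0 <= (v *m mxsub f f E *m v^T) 0 0.
Proof.
move=> ET EE; pose w := v *m rowsub f E.
suff -> : v *m mxsub f f E *m v^T = w *m w^T.
  by rewrite mxE sumr_ge0 // => i _; rewrite [w^T _ _]mxE -expr2 sqr_ge0.
rewrite /w trmx_mul -!mulmxA; congr (_ *m _); rewrite mulmxA; congr (_ *m _).
by rewrite trmx_mxsub ET -mxsub_mul EE.
Qed.

Lemma mxrank_mxsub (F : fieldType) (n a : nat) (E : 'M[F]_n) (f : 'I_a -> 'I_n) :
  (\rank (mxsub f f E) <= \rank E)%N.
Proof.
have -> : mxsub f f E = rowsub f 1%:M *m E *m colsub f 1%:M.
  by rewrite mul_rowsub_mx mul1mx mulmx_colsub mulmx1;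
     apply/matrixP => i j; rewrite !mxE.
exact: leq_trans (mxrankM_maxl _ _) (mxrankM_maxr _ _).
Qed.

Lemma quadratic_scalar_const (R : comNzRingType) (a : nat) (q r : R) (v : 'rV[R]_a) :
  (v *m (q%:M + const_mx r) *m v^T) 0 0
    = q * (\sum_i v 0 i ^+ 2) + r * (\sum_i v 0 i) ^+ 2.
Proof.
rewrite mulmxDr mulmxDl mxE mul_mx_scalar -scalemxAl mxE; congr (q * _ + _).
  by rewrite mxE; apply: eq_bigr => i _; rewrite mxE expr2.
rewrite mxE expr2 mulrA mulr_sumr; apply: eq_bigr => i _; rewrite !mxE.
congr (_ * _); rewrite mulrC mulr_suml; apply: eq_bigr => j _.
by rewrite mxE.
Qed.

(** Semidefiniteness excludes [q%:R < r]. If [q%:R > r], the submatrix is positive definite, hence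
    nonsingular, and its order [a] is at most the rank of [E]. *)
Lemma card_le_rank_pos (R : realFieldType) (n a q : nat) (E : 'M[R]_n)
    (f : 'I_a -> 'I_n) (c r : R) :
  E^T = E -> E *m E = E -> \rank E = q -> (0 < q)%N -> 0 < c -> 0 < r ->
  q%:R != r -> c *: mxsub f f E = (q%:R - r)%:M + const_mx r ->
  (a <= q)%N.
Proof.
move=> ET EE rkE q0 c0 r0 neq_qr subE.
(* The test vector below needs two indices; otherwise [0 < q] suffices. *)
have [a1|a2] := leqP a 1; first exact: leq_trans a1 q0.
have psd (v : 'rV[R]_a) :
    0 <= (q%:R - r) * (\sum_i v 0 i ^+ 2) + r * (\sum_i v 0 i) ^+ 2.
  rewrite -quadratic_scalar_const -subE -scalemxAr -scalemxAl mxE mulr_ge0 ?(ltW c0) //.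
  exact: sym_idem_mxsub_ge0.
have qr : 0 < q%:R - r.
  have i1 : (0 < a)%N by exact: ltnW.
  (* The entries of [v] sum to zero, which removes the constant part and leaves twice [q%:R - r]. *)
  pose v : 'rV[R]_a := delta_mx 0 (Ordinal i1) - delta_mx 0 (Ordinal a2).
  have := psd v.
  have -> : \sum_i v 0 i = 0.
    rewrite (bigD1 (Ordinal i1)) // (bigD1 (Ordinal a2)) //= big1 => [|i /andP[ni nj]].
      by rewrite !mxE /= subr0 sub0r addr0 subrr.
    by rewrite !mxE (negPf ni) (negPf nj) subr0.
  have -> : \sum_i v 0 i ^+ 2 = 2.
    rewrite (bigD1 (Ordinal i1)) // (bigD1 (Ordinal a2)) //= big1 => [|i /andP[ni nj]].
      by rewrite !mxE /= subr0 sub0r addr0 sqrrN expr1n.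
    by rewrite !mxE (negPf ni) (negPf nj) subr0 expr0n.
  by rewrite expr0n mulr0 addr0 pmulr_lge0 // le_eqVlt eq_sym subr_eq0 (negPf neq_qr).
rewrite -rkE; apply: leq_trans (mxrank_mxsub E f).
rewrite -(mxrank_scale_nz _ (lt0r_neq0 c0)) subE.
suff /eqP -> : row_free ((q%:R - r)%:M + const_mx r : 'M[R]_a) by [].
rewrite -kermx_eq0; apply/rowV0P => v /sub_kermxP vM0.
(* At a kernel vector both nonnegative terms of the form vanish, and the first one forces
   [v = 0]. *)
have := quadratic_scalar_const (q%:R - r) r v; rewrite vM0 mul0mx mxE => /esym/eqP.
have sq_ge0 : 0 <= \sum_i v 0 i ^+ 2 by apply: sumr_ge0 => i _; exact: sqr_ge0.
have rsq_ge0 : 0 <= r * (\sum_i v 0 i) ^+ 2 by rewrite mulr_ge0 ?sqr_ge0 ?(ltW r0).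
rewrite paddr_eq0 ?(mulr_ge0 (ltW qr) sq_ge0) // mulf_eq0 (gt_eqF qr) /=.
rewrite psumr_eq0 => [/andP[/allP v0 _]|i _]; last exact: sqr_ge0.
apply/rowP => i; rewrite mxE; apply/eqP; rewrite -sqrf_eq0.
exact: v0 (mem_index_enum i).
Qed.

(** For the first bound, a nonsingular scalar matrix of order [a] is the sum of a matrix of rank at
    most 1 and one of rank at most [q]. The second bound tests semidefiniteness on the all-ones
    vector. *)
Lemma card_le_rank_neg (R : realFieldType) (n a q : nat) (E : 'M[R]_n)
    (f : 'I_a -> 'I_n) (c r : R) :
  E^T = E -> E *m E = E -> \rank E = q -> 0 < c -> 0 < r ->
  c *: mxsub f f E = (q%:R + r)%:M + const_mx (- r) ->
  (a <= 1 + q)%N /\ a%:R <= 1 + q%:R / r.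
Proof.
move=> ET EE rkE c0 r0 subE; split.
  have qr : q%:R + r != 0 by rewrite gt_eqF // ltr_wpDl.
  have <- : \rank ((q%:R + r)%:M : 'M[R]_a) = a.
    by rewrite -scalemx1 mxrank_scale_nz // mxrank1.
  have -> : (q%:R + r)%:M = const_mx r + c *: mxsub f f E :> 'M[R]_a.
    by rewrite subE addrCA -raddfD /= subrr raddf0 addr0.
  apply: leq_trans (mxrank_add _ _) _; apply: leq_add.
    have -> : const_mx r = (const_mx 1 : 'cV[R]_a) *m (const_mx r : 'rV[R]_a).
      by apply/matrixP => i j; rewrite !mxE big_ord1 !mxE mul1r.
    exact: leq_trans (mxrankM_maxl _ _) (rank_leq_col _).
  by rewrite -rkE mxrank_scale_nz ?gt_eqF ?mxrank_mxsub.
have [->|a0] := posnP a; first by rewrite addr_ge0 // divr_ge0 // ltW.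
(* The form at [v] is [a (q + r) - r a^2]; dividing by [a > 0] gives [r a <= q + r]. *)
pose v : 'rV[R]_a := const_mx 1.
have : 0 <= (v *m (c *: mxsub f f E) *m v^T) 0 0.
  by rewrite -scalemxAr -scalemxAl mxE mulr_ge0 ?(ltW c0) ?sym_idem_mxsub_ge0.
rewrite subE quadratic_scalar_const.
rewrite (eq_bigr (fun=> 1)) => [|i _]; last by rewrite mxE expr1n.
rewrite [X in _ * X ^+ 2](eq_bigr (fun=> 1)) => [|i _]; last by rewrite mxE.
rewrite sumr_const card_ord expr2 mulNr mulrA -mulrBl pmulr_lge0 ?ltr0n // => h.
rewrite -(ler_pM2r r0) mulrDl divfK ?gt_eqF // mul1r mulrC.
lra.
Qed.

(** * Spectral idempotents *)

Lemma decr_inj (R : realFieldType) (d : nat) (theta : nat -> R) :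
  (forall i j : nat, (i < j <= d)%N -> theta j < theta i) ->
  {in gtn d.+1 &, injective theta}.
Proof.
move=> dec i j; rewrite !inE => id jd eq_ij.
case: (ltngtP i j) => // [ij|ji].
  by have := dec i j; rewrite ij eq_ij ltxx => /(_ jd).
by have := dec j i; rewrite ji eq_ij ltxx => /(_ id).
Qed.

(** With [L_i] the Lagrange polynomial, [L_i^2 - L_i] and [(X - theta_i) L_i] vanish at every
    [theta j]. The trace picks out [m i], and the rank of an idempotent is its trace. *)
Lemma spectral_idempotent (R : realFieldType) (n d : nat) (A : 'M[R]_n.+1)
    (theta : nat -> R) (m : nat -> nat) (i : nat) :
  A^T = A -> {in gtn d.+1 &, injective theta} ->
  char_poly A = \prod_(i < d.+1) ('X - (theta i)%:P) ^+ m i ->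
  (i <= d)%N ->
  let E := horner_mx A (lagrange_poly d theta i) in
  [/\ E^T = E, E *m E = E, \tr E = (m i)%:R, \rank E = m i
    & E *m A = theta i *: E].
Proof.
move=> Asym theta_inj charA id E.
have ET : E^T = E by exact: trmx_horner_mx.
have EE : E *m E = E.
  apply/eqP; rewrite -subr_eq0 -[_ *m _]/(_ * _) -rmorphM -rmorphB /=; apply/eqP.
  apply: (horner_mx_sym_eq0 Asym theta_inj charA) => j jd.
  by rewrite hornerD hornerN hornerM lagrange_poly_node // -natrM mulnb andbb subrr.
have trE : \tr E = (m i)%:R.
  rewrite (mxtrace_horner_sym _ Asym theta_inj charA).
  rewrite (bigD1 (inord i)) //= inordK // lagrange_poly_node // eqxx big1 ?addr0 //.
  move=> j ji; rewrite lagrange_poly_node // -1?ltnS ?ltn_ord //.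
  have [ij|] := eqVneq i j; last by rewrite mul0rn.
  by case/eqP: ji; apply: val_inj; rewrite /= inordK.
split=> //; first by apply/eqP; rewrite -(eqr_nat R) -trE idem_rank_tr.
apply/eqP; rewrite -subr_eq0 -{1}(horner_mx_X A) -horner_mxZ.
rewrite -[_ *m _]/(_ * _) -rmorphM -rmorphB /=; apply/eqP.
apply: (horner_mx_sym_eq0 Asym theta_inj charA) => j jd.
rewrite hornerD hornerN hornerM (hornerZ (theta i)) hornerX lagrange_poly_node //.
by have [->|_] := eqVneq i j; rewrite ?mul1r ?mulr1 ?mul0r ?mulr0 subrr.
Qed.

(* For [A] nonnegative the left-hand side is a sum of squares, so if [k <= t]
   then [v] is constant along the edges of [A]. *)
Lemma regular_dirichlet_form (R : comNzRingType) (n : nat) (A : 'M[R]_n) (k t : R)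
    (v : 'rV[R]_n) :
  A^T = A -> (forall i, \sum_j A i j = k) -> v *m A = t *: v ->
  \sum_i \sum_j A i j * (v 0 i - v 0 j) ^+ 2 = 2 * (k - t) * \sum_i v 0 i ^+ 2.
Proof.
move=> Asym Areg vA; have Aij i j : A i j = A j i by rewrite -[in LHS]Asym mxE.
have vAj j : \sum_i v 0 i * A i j = t * v 0 j.
  by have /matrixP/(_ 0 j) := vA; rewrite !mxE.
have -> : \sum_i \sum_j A i j * (v 0 i - v 0 j) ^+ 2 =
    \sum_i (\sum_j A i j) * v 0 i ^+ 2 + \sum_j (\sum_i A i j) * v 0 j ^+ 2
    - 2 * \sum_j (\sum_i v 0 i * A i j) * v 0 j.
  rewrite mulr_sumr.
  under [X in _ + X - _]eq_bigr => j _ do rewrite mulr_suml.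
  under [X in _ - X]eq_bigr => j _ do rewrite mulr_suml mulr_sumr.
  rewrite [X in _ + X - _]exchange_big [X in _ - X]exchange_big -sumrN -!big_split /=.
  apply: eq_bigr => i _; rewrite mulr_suml -sumrN -!big_split /=.
  by apply: eq_bigr => j _; ring.
under eq_bigr => i _ do rewrite Areg.
under [X in _ + X - _]eq_bigr => j _ do
  (under eq_bigr => i _ do rewrite Aij; rewrite Areg).
under [X in _ - _ * X]eq_bigr => j _ do rewrite vAj -mulrA -expr2.
by rewrite -!mulr_sumr; ring.
Qed.

(** The row sum [k] is an eigenvalue, so [k <= theta 0], and the Dirichlet form of each row of [E]
    is both nonnegative and nonpositive. Rows are thus constant along edges, hence constant by the
    last hypothesis, which encodes connectedness. *)
Lemma principal_idempotent (R : realFieldType) (n d : nat) (A : 'M[R]_n.+1)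
    (theta : nat -> R) (m : nat -> nat) (k : R) :
  A^T = A -> (forall i j : nat, (i < j <= d)%N -> theta j < theta i) ->
  char_poly A = \prod_(i < d.+1) ('X - (theta i)%:P) ^+ m i -> (0 < m 0)%N ->
  (forall i j, 0 <= A i j) -> (forall i, \sum_j A i j = k) ->
  (forall v : 'rV[R]_n.+1, (forall i j, A i j != 0 -> v 0 i = v 0 j) ->
    forall i j, v 0 i = v 0 j) ->
  horner_mx A (lagrange_poly d theta 0) = const_mx (n.+1%:R^-1).
Proof.
move=> Asym dec charA m0 A0 Areg Aconn; have theta_inj := decr_inj dec.
set E := horner_mx A _.
have [ET EE _ rkE EA] := spectral_idempotent Asym theta_inj charA (leq0n d).
rewrite -/E in ET EE rkE EA.
have k_le : k <= theta 0.
  have : eigenvalue A k.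
    apply/eigenvalueP; exists (const_mx 1).
      apply/rowP => j; rewrite !mxE mulr1 -(Areg j); apply: eq_bigr => i _.
      by rewrite mxE mul1r -[in LHS]Asym mxE.
    by apply/eqP => /rowP/(_ 0)/eqP; rewrite !mxE oner_eq0.
  rewrite eigenvalue_root_char charA /root horner_prod => /prodf_eq0[j _].
  rewrite horner_exp hornerXsubC expf_eq0 subr_eq0 => /andP[_ /eqP ->].
  by case: j => [[|j] jd] //=; rewrite ltW // dec.
have row_const l i j : E l i = E l j.
  suff /Aconn/(_ i j): forall i j, A i j != 0 -> row l E 0 i = row l E 0 j.
    by rewrite !mxE.
  move=> {}i {}j Aij0.
  have rowEA : row l E *m A = theta 0 *: row l E by rewrite -row_mul EA linearZ.
  have form_ge0 i1 j1 : 0 <= A i1 j1 * (row l E 0 i1 - row l E 0 j1) ^+ 2.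
    by rewrite mulr_ge0 ?sqr_ge0.
  have : \sum_i \sum_j A i j * (row l E 0 i - row l E 0 j) ^+ 2 == 0.
    rewrite eq_le; apply/andP; split; last by do 2!apply: sumr_ge0 => ? _.
    rewrite (regular_dirichlet_form Asym Areg rowEA).
    apply: mulr_le0_ge0; first by rewrite pmulr_rle0 // subr_le0.
    by apply: sumr_ge0 => i1 _; exact: sqr_ge0.
  rewrite psumr_eq0 => [/allP/(_ i (mem_index_enum _)) /=|i1 _]; last by apply: sumr_ge0.
  rewrite psumr_eq0 => // /allP/(_ j (mem_index_enum _)) /=.
  by rewrite mulf_eq0 (negPf Aij0) sqrf_eq0 subr_eq0 => /eqP.
have E_const : E = const_mx (E 0 0).
  apply/matrixP => i j; rewrite mxE (row_const i j 0) -[in LHS]ET mxE.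
  exact: row_const.
have c_neq0 : E 0 0 != 0.
  apply/eqP => c0; move: rkE; rewrite E_const c0 (_ : const_mx 0 = 0) ?mxrank0.
    by move=> m00; rewrite -m00 in m0.
  by apply/matrixP => i j; rewrite !mxE.
(* Idempotence gives [n.+1 * c^2 = c] for the common nonzero entry [c]. *)
rewrite E_const; congr const_mx; apply: (mulfI c_neq0).
have /matrixP/(_ 0 0) := EE; rewrite {1 2}E_const !mxE.
rewrite (eq_bigr (fun=> E 0 0 * E 0 0)) => [|i _]; last by rewrite !mxE.
rewrite sumr_const card_ord => h.
have n0 : n.+1%:R != 0 :> R by rewrite pnatr_eq0.
by apply: (mulIf n0); rewrite mulr_natr h divfK.
Qed.

(** * Idempotents on a set of far vertices *)

Lemma idempotent_mxsub (R : realFieldType) (n a d : nat) (A : 'M[R]_n.+1)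
    (theta : nat -> R) (m : nat -> nat) (f : 'I_a -> 'I_n.+1) (i : nat) :
  A^T = A -> (forall i j : nat, (i < j <= d)%N -> theta j < theta i) ->
  char_poly A = \prod_(i < d.+1) ('X - (theta i)%:P) ^+ m i ->
  horner_mx A (lagrange_poly d theta 0) = const_mx (n.+1%:R^-1) ->
  (forall k x y, (A ^+ k) x x = (A ^+ k) y y) ->
  (forall k x y, (k < d)%N -> x != y -> (A ^+ k) (f x) (f y) = 0) ->
  (i <= d)%N ->
  let r := (-1) ^+ i * (spi d theta 0 / spi d theta i) in
  n.+1%:R *: mxsub f f (horner_mx A (lagrange_poly d theta i))
    = ((m i)%:R - r)%:M + const_mx r.
Proof.
move=> Asym dec charA E0 diagA farA id r; have theta_inj := decr_inj dec.
have [_ _ trE _ _] := spectral_idempotent Asym theta_inj charA id.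
have n0 : n.+1%:R != 0 :> R by rewrite pnatr_eq0.
have spi0 j : (j <= d)%N -> spi d theta j != 0.
  by move=> jd; rewrite gt_eqF ?spi_gt0.
have farE j x y : (j <= d)%N -> x != y ->
    horner_mx A (lagrange_poly d theta j) (f x) (f y)
      = ((-1) ^+ j * spi d theta j)^-1 * (A ^+ d) (f x) (f y).
  move=> jd xy; rewrite (horner_mx_coef _ _ _ (size_lagrange_poly _ jd)).
  rewrite big_ord_recr /= big1 ?add0r => [|k _]; last by rewrite farA ?mulr0.
  by rewrite lagrange_poly_coef ?prod_sub_spi.
apply/matrixP => x y; rewrite !mxE; have [<-|xy] := eqVneq x y.
  (* The diagonal is constant, so [n.+1] times one entry is the trace. *)
  rewrite mulr1n subrK -trE /mxtrace.
  rewrite (eq_bigr (fun=> horner_mx A (lagrange_poly d theta i) (f x) (f x))).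
    by rewrite sumr_const card_ord mulr_natl.
  move=> z _; rewrite !(horner_mx_coef _ _ _ (leqnn _)).
  by apply: eq_bigr => k _; rewrite (diagA k z (f x)).
rewrite mulr0n add0r farE //.
(* The entry of [A ^+ d] is read off from the known idempotent of index 0, then substituted into
   that of index [i]. *)
have := farE 0 x y (leq0n d) xy; rewrite E0 mxE expr0 mul1r => h.
have -> : (A ^+ d) (f x) (f y) = spi d theta 0 / n.+1%:R.
  by rewrite h mulrA divff ?mul1r ?spi0.
rewrite /r invfM (invr_sign).
by rewrite mulrC -!mulrA; congr (_ * _); rewrite mulVf // mulr1 mulrC.
Qed.

(** The parity of [i] decides the sign of [r], hence which of the two rank bounds applies. *)
Lemma far_set_card_le (R : realFieldType) (n a d : nat) (A : 'M[R]_n)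
    (theta : nat -> R) (m : nat -> nat) (f : 'I_a -> 'I_n) (i : nat) :
  A^T = A -> (forall i j, A i j ^+ 2 = A i j) ->
  (forall v : 'rV[R]_n, (forall i j, A i j != 0 -> v 0 i = v 0 j) ->
    forall i j, v 0 i = v 0 j) ->
  (forall i j : nat, (i < j <= d)%N -> theta j < theta i) ->
  (forall i : nat, (i <= d)%N -> (0 < m i)%N) ->
  char_poly A = \prod_(i < d.+1) ('X - (theta i)%:P) ^+ m i ->
  (forall k x y, (A ^+ k) x x = (A ^+ k) y y) ->
  (forall k x y, (k < d)%N -> x != y -> (A ^+ k) (f x) (f y) = 0) ->
  (i <= d)%N ->
  if odd i then
    (a <= 1 + m i)%N /\ a%:R <= 1 + (m i)%:R * spi d theta i / spi d theta 0
  else (m i)%:R != spi d theta 0 / spi d theta i -> (a <= m i)%N.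
Proof.
move=> Asym A01 Aconn dec m0 charA diagA farA id; have theta_inj := decr_inj dec.
have spi_pos j : (j <= d)%N -> 0 < spi d theta j by move=> jd; exact: spi_gt0.
(* Order 0, for which [horner_mx] is not typed, forces [a = 0]. *)
case: n => [|n] in A f Asym A01 Aconn charA diagA farA *.
  have a0 : a = 0%N by case: a f farA => // a f _; case: (f 0).
  case: ifP => _; rewrite a0 //; split=> //.
  by rewrite addr_ge0 // !mulr_ge0 ?invr_ge0 // ltW // spi_pos.
(* For a symmetric 0/1 matrix the row sums are the diagonal of [A ^+ 2]: equal numbers of closed
   walks of length 2 give regularity. *)
have Areg x : \sum_y A x y = \sum_y A 0 y.
  suff sumE z : \sum_y A z y = (A ^+ 2) z z by rewrite !sumE (diagA 2%N x 0).
  rewrite expr2 mxE; apply: eq_bigr => y _.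
  by rewrite -[in A y z]Asym mxE -expr2 A01.
have A_ge0 x y : 0 <= A x y by rewrite -A01 sqr_ge0.
have E0 := principal_idempotent Asym dec charA (m0 0%N (leq0n d)) A_ge0 Areg Aconn.
have [ET EE _ rkE _] := spectral_idempotent Asym theta_inj charA id.
have := idempotent_mxsub Asym dec charA E0 diagA farA id.
rewrite /= -signr_odd; case: (odd i) => subE; last first.
  move=> neq; apply: (card_le_rank_pos (f := f) ET EE rkE (m0 i id) (ltr0Sn R n) _ neq).
    by rewrite divr_gt0 ?spi_pos.
  by rewrite subE expr0 mul1r.
rewrite -mulrA -invf_div; apply: (card_le_rank_neg (f := f) ET EE rkE (ltr0Sn R n)).
  by rewrite divr_gt0 ?spi_pos.
by rewrite subE expr1 mulN1r opprK.
Qed.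

(** * Walks, powers of the adjacency matrix and distance *)

Lemma card_walksS (T : finType) (e : rel T) k x y :
  #|walks e k.+1 x y| = (\sum_z e x z * #|walks e k z y|)%N.
Proof.
rewrite -sum1_card big_mkcond /=.
(* As the start is not stored, the head of the tuple is the vertex reached by the first step. *)
rewrite (reindex (fun p : T * k.-tuple T => cons_tuple p.1 p.2)) /=; last first.
  exists (fun t : k.+1.-tuple T => (thead t, [tuple of behead t])) => [[z t] _|t _] /=.
    by congr (_, _); apply: val_inj.
  by rewrite [RHS]tuple_eta; apply: val_inj.
rewrite -(pair_big xpredT xpredT (fun z (t : k.-tuple T) =>
  if cons_tuple z t \in walks e k.+1 x y then 1 else 0)%N) /=.
apply: eq_bigr => z _; rewrite -sum1_card big_distrr /= [RHS]big_mkcond /=.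
by apply: eq_bigr => t _; rewrite !inE /= -andbA; case: (e x z); case: (path _ _ _ && _).
Qed.

Lemma adjmx_exp (R : pzRingType) (T : finType) (e : rel T) k i j :
  (adjmx R e ^+ k) i j = #|walks e k (enum_val i) (enum_val j)|%:R.
Proof.
elim: k i => [|k IHk] i.
  rewrite expr0 [LHS]mxE; congr (_%:R).
  rewrite -(inj_eq enum_val_inj); have [eij|neq] := eqVneq (enum_val i) (enum_val j).
    rewrite (_ : walks _ _ _ _ = setT) ?cardsT ?card_tuple //.
    by apply/setP => t; rewrite !inE [t]tuple0 /= eij eqxx.
  rewrite (_ : walks _ _ _ _ = set0) ?cards0 //.
  by apply/setP => t; rewrite !inE [t]tuple0 /= (negPf neq).
rewrite exprS card_walksS natr_sum [LHS]mxE (reindex _ (onW_bij _ (enum_val_bij T))) /=.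
by apply: eq_bigr => z _; rewrite IHk mxE natrM.
Qed.

(** [gdist] never exceeds [#|T|], so [k] lies in the search range; a failed search also rules out
    every length in that range. *)
Lemma walks_lt_gdist (T : finType) (e : rel T) k x y :
  (k < gdist e x y)%N -> walks e k x y = set0.
Proof.
move=> kd; have kT : (k < #|T|)%N.
  by apply: leq_trans kd _; rewrite -[leqRHS](size_iota 0) find_size.
by have := before_find 0%N kd; rewrite nth_iota // => /negbFE/eqP.
Qed.

(** * Bounds on the independence number *)

(** An iterated maximum is its base value 0 or one of the listed values. A general [P] allows bounds
    in [nat] and in [R] together. *)
Lemma k_indep_number_ind (T : finType) (e : rel T) k (P : nat -> Prop) :
  P 0%N -> (forall U : {set T}, k_independent e k U -> P #|U|) ->
  P (k_indep_number e k).
Proof.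
by move=> P0 PU; apply: big_ind => // x y Px Py; rewrite /maxn; case: ifP.
Qed.

Lemma walk_regular_card_le (R : realFieldType) (T : finType) (e : rel T) (d : nat)
    (theta : nat -> R) (m : nat -> nat) (U : {set T}) (i : nat) :
  simple_graph e -> connected_graph e -> walk_regular e ->
  has_spectrum e d theta m -> k_independent e (d - 1) U -> (i <= d)%N ->
  if odd i then
    (#|U| <= 1 + m i)%N /\ #|U|%:R <= 1 + (m i)%:R * spi d theta i / spi d theta 0
  else (m i)%:R != spi d theta 0 / spi d theta i -> (#|U| <= m i)%N.
Proof.
move=> [esym _] econn ereg [dec m0 charA] indU.
apply: (@far_set_card_le R _ _ d (adjmx R e) theta m
  (fun x : 'I_#|U| => enum_rank (enum_val x))) => //.
- by apply/matrixP => x y; rewrite !mxE esym.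
- by move=> x y; rewrite mxE; case: (e _ _); rewrite ?expr1n ?expr0n.
(* Equality of values propagates along a path from [x] to [y]. *)
- move=> v v_edge x y; have /connectP[p pth lastp] := econn (enum_val x) (enum_val y).
  rewrite -[y]enum_valK lastp; elim: p x pth {lastp} => [|z p IHp] x /=.
    by rewrite enum_valK.
  move=> /andP[exz]; rewrite -(enum_rankK z) => /IHp <-.
  by apply: v_edge; rewrite mxE enum_rankK exz oner_eq0.
- by move=> k x y; rewrite !adjmx_exp (ereg k _ (enum_val y)).
- move=> k x y kd xy; rewrite adjmx_exp !enum_rankK walks_lt_gdist ?cards0 //.
  move: indU => /forall_inP/(_ _ (enum_valP x))/forall_inP/(_ _ (enum_valP y)).
  rewrite (inj_eq enum_val_inj) xy /=; apply: leq_ltn_trans.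
  (* [k < d] makes [d] positive, so the truncated [d - 1] is a true predecessor. *)
  by rewrite -ltnS subn1 prednK // (leq_ltn_trans _ kd).
Qed.

Theorem theorem4p3 (R : rcfType) (T : finType) (e : rel T) (d : nat)
    (theta : nat -> R) (m : nat -> nat)
    (Hsimple : simple_graph e)
    (Hconn : connected_graph e)
    (Hwreg : walk_regular e)
    (Hspec : has_spectrum e d theta m) :
  (forall i : nat, (1 <= i <= d./2)%N ->
     (m (2 * i)%N)%:R != spi d theta 0 / spi d theta (2 * i)%N ->
     (k_indep_number e (d - 1) <= m (2 * i)%N)%N)
  /\
  (forall i : nat, (1 <= i <= uphalf d)%N ->
     (k_indep_number e (d - 1) <= 1 + m (2 * i - 1)%N)%N
     /\ (k_indep_number e (d - 1))%:R
          <= 1 + (m (2 * i - 1)%N)%:R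
                 * spi d theta (2 * i - 1)%N / spi d theta 0).
Proof.
(* Positivity settles the second bound of the odd case at the base value 0 of the maximum. *)
have spi0 i : (i <= d)%N -> 0 < spi d theta i.
  by case: Hspec => dec _ _ id; rewrite spi_gt0 //; exact: decr_inj.
split=> i /andP[i_gt0 i_le].
  have id : (2 * i <= d)%N by lia.
  move=> neq; apply: (@k_indep_number_ind T e (d - 1)
    (fun a => a <= m (2 * i))%N) => // U indU.
  have := walk_regular_card_le Hsimple Hconn Hwreg Hspec indU id.
  by rewrite mul2n odd_double -mul2n; apply.
have id : (2 * i - 1 <= d)%N by lia.
have odd_i : odd (2 * i - 1) by lia.
apply: (@k_indep_number_ind T e (d - 1)
  (fun a => (a <= 1 + m (2 * i - 1))%N /\
     a%:R <= 1 + (m (2 * i - 1)%N)%:R * spi d theta (2 * i - 1) / spi d theta 0)).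
  by split=> //; rewrite addr_ge0 // divr_ge0 ?mulr_ge0 // ltW // spi0.
move=> U indU; have := walk_regular_card_le Hsimple Hconn Hwreg Hspec indU id.
by rewrite odd_i.
Qed.
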